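(* Let $E$ be a uniformly convex real Banach space whose norm is uniformly Gâteaux differentiable, $C$ a nonempty closed convex subset of $E$, $\{T_n\}_{n\in\mathbb N}$ a sequence of nonexpansive self-mappings of $C$, $\{\alpha_n\}_{n\in\mathbb N}$ a sequence in $(0,1]$ with $\alpha_n\to0$ and $\sum_{n=1}^\infty\alpha_n=\infty$, $\{\beta_n^k\}$ a double sequence in $(0,1]$ indexed by $n\in\mathbb N$ and $k\in\{1,\dots,n\}$, and $\{\gamma_n\}_{n\in\mathbb N}$ a sequence in $(0,1)$. Suppose that $\mathrm F(\{T_n\})$ is nonempty, $\sum_{k=1}^n\beta_n^k=1$ for all $n\in\mathbb N$, $\inf\{\beta_n^k:n\ge k\}>0$ for all $k\in\mathbb N$, $\inf_n\gamma_n>0$, and $\sup_n\gamma_n<1$. Let $u$ be a point in $C$ and $\{x_n\}$ the sequence defined by $x_1\in C$ (arbitrary) and $$x_{n+1}=\alpha_nu+(1-\alpha_n)\Bigl[\gamma_nx_n+(1-\gamma_n)\sum_{k=1}^n\beta_n^kT_kx_n\Bigr]\qquad(n\in\mathbb N).$$ Then $\{x_n\}$ converges strongly (i.e. in norm) to $Qu$, where $Q$ is the sunny nonexpansive retraction of $C$ onto $\mathrm F(\{T_n\})$.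
   Context: $\mathbb N$ is the set of positive integers. For a mapping $T\colon C\to E$ with $C\subset E$, $\mathrm F(T)=\{x\in C: Tx=x\}$; for a sequence $\{T_n\}$ of mappings $C\to E$, $\mathrm F(\{T_n\})=\bigcap_{n=1}^\infty \mathrm F(T_n)$. $T$ is nonexpansive if $\|Tx-Ty\|\le\|x-y\|$ for all $x,y\in C$. With $U_E=\{x\in E:\|x\|=1\}$: the norm of $E$ is uniformly Gâteaux differentiable if for each $y\in U_E$ the limit $\lim_{t\to0}(\|x+ty\|-\|x\|)/t$ exists for all $x\in U_E$ and is attained uniformly for $x\in U_E$; $E$ is uniformly convex if for any $\epsilon>0$ there exists $\delta>0$ such that $x,y\in U_E$ and $\|x-y\|\ge\epsilon$ imply $\|x+y\|/2\le1-\delta$. For nonempty $K\subset C$, a mapping $Q$ of $C$ onto $K$ is a retraction if $Qx=x$ for all $x\in K$; it is sunny if $Q(Qx+\lambda(x-Qx))=Qx$ whenever $x\in C$, $\lambda\ge0$ and $Qx+\lambda(x-Qx)\in C$. A sunny nonexpansive retraction is a retraction that is sunny and nonexpansive. Under the stated assumptions there is a unique sunny nonexpansive retraction of $C$ onto $\mathrm F(\{T_n\})$. *)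

(* Defs.v *)
From HB Require Import structures.
From mathcomp Require Import all_boot all_order all_algebra.
From mathcomp Require Import boolp classical_sets functions reals topology.
From mathcomp Require Import normedtype sequences convex.
Set Implicit Arguments.
Unset Strict Implicit.
Unset Printing Implicit Defensive.
Import Order.TTheory GRing.Theory Num.Theory.
Import numFieldNormedType.Exports.
Local Open Scope classical_set_scope.
Local Open Scope ring_scope.

(* A mapping C -> E is represented by a total function E -> E; every notion
   below is relative to C and ignores the values outside C.  Sequences indexed
   by the positive integers are functions on nat whose value at 0 is ignored. *)

Definition unit_sphere (R : realType) (E : normedModType R) : set E :=
  [set x | `|x| = 1].
Arguments unit_sphere {R} E.

Definition uniformly_gateaux_differentiable_norm
    (R : realType) (E : normedModType R) : Prop :=
  forall y : E, unit_sphere E y ->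
    exists g : E -> R,
      {uniform unit_sphere E,
        (fun (t : R) (x : E) => (`|x + t *: y| - `|x|) / t) @ (0 : R)^' --> g}.
Arguments uniformly_gateaux_differentiable_norm {R} E.

Definition uniformly_convex (R : realType) (E : normedModType R) : Prop :=
  forall eps : R, 0 < eps -> exists2 delta : R, 0 < delta &
    forall x y : E, unit_sphere E x -> unit_sphere E y ->
      eps <= `|x - y| -> `|x + y| / 2 <= 1 - delta.
Arguments uniformly_convex {R} E.

Definition nonexpansive (R : realType) (E : normedModType R)
    (C : set E) (f : E -> E) : Prop :=
  1.-lipschitz_C f.

Definition fixed_points (E : Type) (C : set E) (f : E -> E) : set E :=
  [set x | C x /\ f x = x].

Definition common_fixed_points (E : Type) (C : set E) (T : nat -> E -> E) :
    set E :=
  \bigcap_(n in [set n | (0 < n)%N]) fixed_points C (T n).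

Definition retraction (E : Type) (C K : set E) (Q : E -> E) : Prop :=
  Q @` C = K /\ (forall x, K x -> Q x = x).

Definition sunny (R : realType) (E : normedModType R)
    (C : set E) (Q : E -> E) : Prop :=
  forall (x : E) (lambda : R), C x -> 0 <= lambda ->
    C (Q x + lambda *: (x - Q x)) -> Q (Q x + lambda *: (x - Q x)) = Q x.

Definition sunny_nonexpansive_retraction (R : realType) (E : normedModType R)
    (C K : set E) (Q : E -> E) : Prop :=
  [/\ retraction C K Q, sunny C Q & nonexpansive C Q].

(* Main.v *)
(* For a point [u] of [C], let [z n] be the fixed point of the contraction
   [y |-> t u + (1 - t) V y] with [t = 1 / (n + 1)], where [V] is the averaged
   mapping of step [n + 1] of the iteration.  Uniform convexity makes [z n]
   almost fixed by every [T k], so its asymptotic center [q] is a common fixed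
   point; since the norm is smooth, comparing [q] with [q + s (u - q)] shows
   that the asymptotic radius is zero, that is, [z n] tends to [q].  The limit
   solves the variational inequality [duality (y - q) (u - q) <= 0], which
   characterizes the sunny nonexpansive retraction.  For the iterates, either
   [|x n - q|] drops by a fixed amount, or [x n] is almost fixed by the mappings
   and [duality (x n.+1 - q) (u - q)] is almost nonpositive; once [alpha n] is
   small, both cases give [theta n.+1 <= (1 - alpha n) theta n + alpha n * e] for
   [theta n = |x n - q|^2], and the divergence of the sum of the [alpha n]
   concludes. *)
Require Import Defs.
From HB Require Import structures.
From mathcomp Require Import all_boot all_order all_algebra.
From mathcomp Require Import ring lra.
From mathcomp Require Import boolp classical_sets functions reals topology.
From mathcomp Require Import interval_inference.
From mathcomp Require Import normedtype sequences convex.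
Import Order.TTheory GRing.Theory Num.Theory.
Import numFieldNormedType.Exports.
Local Open Scope classical_set_scope.
Local Open Scope ring_scope.

(** * Geometry of the norm and the duality pairing *)

Lemma convex_subE {R : pzRingType} {V : lmodType R} (a : R) (v w y : V) :
  a *: v + (1 - a) *: w - y = a *: (v - y) + (1 - a) *: (w - y).
Proof.
rewrite !scalerBr addrACA -opprD -scalerDl [a + _]addrC subrK.
by rewrite scale1r.
Qed.

Lemma norm_convex_le {R : realType} {E : normedModType R} (a r : R) (v w : E) :
  0 <= a <= 1 -> `|v| <= r -> `|w| <= r -> `|a *: v + (1 - a) *: w| <= r.
Proof.
move=> /andP[a0 a1] vr wr; apply: le_trans (ler_normD _ _) _.
rewrite !normrZ ger0_norm // (@ger0_norm _ (1 - a)) ?subr_ge0 //.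
nra.
Qed.

Lemma sqr_norm_convex {R : realType} {E : normedModType R} (a : R) (v w : E) :
  0 <= a <= 1 ->
  `|a *: v + (1 - a) *: w| ^+ 2 <= a * `|v| ^+ 2 + (1 - a) * `|w| ^+ 2.
Proof.
move=> /andP[a0 a1]; set z := _ + _.
have zle : `|z| <= a * `|v| + (1 - a) * `|w|.
  apply: le_trans (ler_normD _ _) _.
  by rewrite !normrZ ger0_norm // (@ger0_norm _ (1 - a)) ?subr_ge0.
have z0 : 0 <= `|z| by [].
have : 0 <= a * (1 - a) * (`|v| - `|w|) ^+ 2.
  by rewrite mulr_ge0 ?sqr_ge0 // mulr_ge0 // subr_ge0.
move: zle z0; move: `|z| `|v| `|w| => p q s zle z0 h.
have : p ^+ 2 <= (a * q + (1 - a) * s) ^+ 2.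
  by rewrite ler_sqr ?nnegrE //; apply: le_trans zle.
lra.
Qed.

Definition sqr_norm_slope {R : realType} {E : normedModType R}
  (x y : E) (t : R) : R := (`|x + t *: y| ^+ 2 - `|x| ^+ 2) / (2 * t).

(* The one-sided derivative of [|.|^2 / 2] at [x] in direction [y]; in a smooth
   space this is [<y, J x>] for the normalized duality mapping [J]. *)
Definition duality {R : realType} {E : normedModType R} (x y : E) : R :=
  inf [set sqr_norm_slope x y t | t in [set t | 0 < t]].

Lemma sqr_norm_slope_lbound {R : realType} {E : normedModType R}
  (x y : E) (t : R) : 0 < t -> - (`|x| * `|y|) <= sqr_norm_slope x y t.
Proof.
move=> t0; rewrite /sqr_norm_slope ler_pdivlMr ?mulr_gt0 //.
have h : `|x| - t * `|y| <= `|x + t *: y|.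
  have := ler_normB (x + t *: y) (t *: y); rewrite addrK normrZ gtr0_norm //.
  lra.
(* A square lies above its tangent at [|x|], which covers the case where [|x| - t * |y|] is
   negative. *)
have : 0 <= `|x| by []. have : 0 <= (`|x + t *: y| - `|x|) ^+ 2 by rewrite sqr_ge0.
nra.
Qed.

(** [x + s *: y] is the convex combination of [x + t *: y] and [x] with weight [s / t], and the
    squared norm is convex. Hence the infimum in [duality] is the limit of the slopes as [t]
    decreases to 0. *)
Lemma sqr_norm_slope_mono {R : realType} {E : normedModType R}
  (x y : E) (s t : R) : 0 < s -> s <= t ->
  sqr_norm_slope x y s <= sqr_norm_slope x y t.
Proof.
move=> s0 st; have t0 : 0 < t by apply: lt_le_trans st.
have a01 : 0 <= s / t <= 1.
  by rewrite ler_pdivrMr // mul1r st andbT ltW // divr_gt0.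
have := sqr_norm_convex (s / t) (x + t *: y) x a01.
rewrite scalerDr scalerA divfK ?gt_eqF // addrAC -scalerDl.
rewrite [s / t + _]addrC subrK scale1r => h.
rewrite /sqr_norm_slope ler_pdivrMr ?mulr_gt0 //.
apply: le_trans (_ : s / t * (`|x + t *: y| ^+ 2 - `|x| ^+ 2) <= _).
  by rewrite lerBlDr; lra.
rewrite le_eqVlt; apply/orP; left; apply/eqP; field.
by rewrite gt_eqF.
Qed.

Lemma duality_has_inf {R : realType} {E : normedModType R} (x y : E) :
  has_inf [set sqr_norm_slope x y t | t in [set t | 0 < t]].
Proof.
split; first by exists (sqr_norm_slope x y 1); exists 1 => //=.
exists (- (`|x| * `|y|)) => _ [t /= t0 <-]; exact: sqr_norm_slope_lbound.
Qed.

Lemma duality_le_slope {R : realType} {E : normedModType R} (x y : E) (t : R) :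
  0 < t -> duality x y <= sqr_norm_slope x y t.
Proof.
move=> t0; apply: ge_inf; first by case: (duality_has_inf x y).
by exists t.
Qed.

Lemma duality_near_slope {R : realType} {E : normedModType R}
  (x y : E) (eps : R) : 0 < eps ->
  exists2 t : R, 0 < t & forall s, 0 < s -> s <= t ->
    sqr_norm_slope x y s < duality x y + eps.
Proof.
move=> e0; have [_ [t /= t0 <-] ht] := inf_adherent e0 (duality_has_inf x y).
exists t => // s s0 st; apply: le_lt_trans ht; exact: sqr_norm_slope_mono.
Qed.

Lemma duality_opp_opp {R : realType} {E : normedModType R} (x y : E) :
  duality (- x) (- y) = duality x y.
Proof.
rewrite /duality; congr (inf (image _ _)); apply/funext => t.
by rewrite /sqr_norm_slope scalerN -opprD !normrN.
Qed.

(** [x + t *: (y + z)] is the midpoint of [x + (2 * t) *: y] and [x + (2 * t) *: z]. *)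
Lemma sqr_norm_slopeD {R : realType} {E : normedModType R}
  (x y z : E) (t : R) : 0 < t ->
  sqr_norm_slope x (y + z) t
  <= sqr_norm_slope x y (2 * t) + sqr_norm_slope x z (2 * t).
Proof.
move=> t0; have a01 : 0 <= (2^-1 : R) <= 1 by lra.
have := sqr_norm_convex 2^-1 (x + (2 * t) *: y) (x + (2 * t) *: z) a01.
have -> : 1 - 2^-1 = 2^-1 :> R by lra.
rewrite -scalerDr addrACA -scalerDr [2^-1 *: _]scalerDr !scalerA.
rewrite mulrA mulVf ?pnatr_eq0 // mul1r scalerDr -scalerDl.
rewrite (_ : 2^-1 + 2^-1 = 1 :> R); last by lra.
rewrite scale1r => h.
rewrite /sqr_norm_slope -mulrDl ler_pdivrMr ?mulr_gt0 //.
have -> : forall w : R, w / (2 * (2 * t)) * (2 * t) = w / 2.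
  by move=> w; field; rewrite gt_eqF.
lra.
Qed.

Lemma duality_subadd {R : realType} {E : normedModType R} (x y z : E) :
  duality x (y + z) <= duality x y + duality x z.
Proof.
apply/ler_addgt0Pr => e e0; have e20 : 0 < e / 2 by rewrite divr_gt0.
have [t t0 ht] := duality_near_slope x y (e / 2) e20.
have [s s0 hs] := duality_near_slope x z (e / 2) e20.
pose r := Num.min t s / 2.
have r0 : 0 < r by rewrite divr_gt0 // lt_min t0.
have rt : 2 * r <= t by rewrite /r mulrCA divff ?pnatr_eq0 // mulr1 ge_min lexx.
have rs : 2 * r <= s by rewrite /r mulrCA divff ?pnatr_eq0 // mulr1 ge_min lexx orbT.
have := duality_le_slope x (y + z) r r0.
have := sqr_norm_slopeD x y z r r0.
have r20 : 0 < 2 * r by rewrite mulr_gt0.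
have := ht (2 * r) r20 rt; have := hs (2 * r) r20 rs.
lra.
Qed.

Lemma uniform_gateaux_quotient {R : realType} {E : normedModType R}
  (y : E) (eps : R) : uniformly_gateaux_differentiable_norm E ->
  `|y| = 1 -> 0 < eps ->
  exists g : E -> R, exists2 d : R, 0 < d & forall t x, t != 0 -> `|t| < d ->
    `|x| = 1 -> `|(`|x + t *: y| - `|x|) / t - g x| < eps.
Proof.
move=> uG y1 e0; have [g hg] := uG y y1; exists g.
have : nbhs (g : {uniform` unit_sphere E -> R})
  [set h : {uniform` unit_sphere E -> R} |
    forall x, unit_sphere E x -> ball (g x) eps (h x)].
  apply/uniform_nbhs; exists [set xy | ball xy.1 eps xy.2].
  by split => //; rewrite -entourage_ballE; exists eps.
move=> /hg; rewrite /= /nbhs /= => /nbhs_ballP[d /= d0 hd].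
exists d => // t x t0 td x1; rewrite distrC.
by have := hd t; rewrite /ball /= sub0r normrN => /(_ td t0 x x1).
Qed.

(* Convexity of the square turns a first-order estimate of the second
   difference of the norm into one for its square; near the origin, where
   normalizing [x] is useless, the second difference is of order [t ^ 2]. *)
Lemma sqr_norm_second_difference {R : realType} {E : normedModType R}
  (y : E) (M eps : R) : uniformly_gateaux_differentiable_norm E -> 0 < eps ->
  exists2 t : R, 0 < t & forall x, `|x| <= M ->
    `|x + t *: y| ^+ 2 + `|x - t *: y| ^+ 2 - 2 * `|x| ^+ 2 <= eps * t.
Proof.
move=> uG e0; have [->|y0] := eqVneq y 0.
  exists 1 => // x _; rewrite scaler0 addr0 subr0; nra.
have c0 : 0 < `|y| by rewrite normr_gt0.
(* [M] may be enlarged; it must be positive to serve as a divisor in [e1]. *)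
wlog M0 : M / 0 < M.
  move=> /(_ (Num.max M 1)); rewrite lt_max ltr01 orbT => /(_ isT)[t t0 ht].
  by exists t => // x xM; apply: ht; rewrite le_max xM.
have [c cE] : exists c, c = `|y| by eexists.
pose yh := c^-1 *: y; rewrite -cE in c0.
have yh1 : `|yh| = 1.
  by rewrite /yh normrZ gtr0_norm ?invr_gt0 // -cE mulVf // gt_eqF.
have [e1 e1E] : exists e1, e1 = eps / (8 * M * c) by eexists.
have e10 : 0 < e1 by rewrite e1E divr_gt0 // !mulr_gt0.
have [g [d d0 hd]] := uniform_gateaux_quotient yh e1 uG yh1 e10.
(* Adding the quotients at [t] and [- t] cancels the derivative [g x]. *)
have unit_bound (x : E) (t : R) : `|x| = 1 -> 0 < t -> t < d ->
    `|x + t *: yh| + `|x - t *: yh| - 2 <= 2 * e1 * t.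
  move=> x1 t0 td.
  have := hd t x (lt0r_neq0 t0); rewrite gtr0_norm // => /(_ td x1).
  have := hd (- t) x; rewrite oppr_eq0 normrN gtr0_norm //.
  move=> /(_ (lt0r_neq0 t0) td x1).
  rewrite x1 scaleNr invrN mulrN !ltr_norml => /andP[h1 _] /andP[_ h2].
  have : (`|x + t *: yh| - 1) / t + (`|x - t *: yh| - 1) / t < 2 * e1 by lra.
  rewrite -mulrDl ltr_pdivrMr //; lra.
have ball_bound (x : E) (t : R) : `|x| <= M -> 0 < t ->
    `|x + t *: yh| ^+ 2 + `|x - t *: yh| ^+ 2 - 2 * `|x| ^+ 2
    <= 4 * M * e1 * t + (4 / d + 2) * t ^+ 2.
  move=> xM t0.
  have ha : `| `|x + t *: yh| - `|x| | <= t.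
    apply: le_trans (ler_dist_dist _ _) _.
    by rewrite [x + _]addrC addrK normrZ yh1 mulr1 gtr0_norm.
  have hb : `| `|x - t *: yh| - `|x| | <= t.
    apply: le_trans (ler_dist_dist _ _) _.
    by rewrite [x - _]addrC addrK normrN normrZ yh1 mulr1 gtr0_norm.
  have r0 : 0 <= `|x| by [].
  have key : 2 * `|x| * (`|x + t *: yh| + `|x - t *: yh| - 2 * `|x|)
      <= 4 * M * e1 * t + 4 / d * t ^+ 2.
    have [hdt|hdt] := ltP t (`|x| * d).
      have xp : 0 < `|x| by rewrite -(pmulr_lgt0 _ d0); apply: lt_trans hdt.
      have x1 : `| `|x|^-1 *: x | = 1.
        by rewrite normrZ gtr0_norm ?invr_gt0 // mulVf // gt_eqF.
      have := unit_bound _ (`|x|^-1 * t) x1.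
      rewrite mulr_gt0 ?invr_gt0 // ltr_pdivrMl // => /(_ isT hdt).
      rewrite -!scalerA -scalerBr -scalerDr !normrZ !gtr0_norm ?invr_gt0 //.
      move=> /(ler_wpM2l r0); rewrite !mulrDr !mulVKf ?gt_eqF // => h.
      have : 0 <= 4 / d * t ^+ 2 by rewrite mulr_ge0 ?sqr_ge0 // divr_ge0 // ltW.
      have : `|x| * (2 * e1 * (`|x|^-1 * t)) = 2 * e1 * t.
        by field; rewrite gt_eqF.
      have : 0 <= e1 * t by apply/ltW; rewrite mulr_gt0.
      move: h xM r0; nra.
    have h1 : `|x| <= t / d by rewrite ler_pdivlMr.
    have : 0 <= 4 * M * e1 * t by apply/ltW; rewrite !mulr_gt0.
    have -> : 4 / d * t ^+ 2 = 4 * (t / d) * t by field; rewrite gt_eqF.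
    move: ha hb; rewrite !ler_norml => /andP[_ ha] /andP[_ hb].
    move: r0 h1 ha hb t0; move: `|x| (t / d) `|_ + _| `|_ - _| (4 * M * e1 * t).
    move=> r s a b z; nra.
  (* With [r = |x|] and [a], [b] the two shifted norms, [a^2 + b^2 - 2 r^2 = 2 r (a + b - 2 r) + (a
     - r)^2 + (b - r)^2]; [key] bounds the first term and each square is at most [t^2]. *)
  move: ha hb; rewrite !ler_norml => /andP[ha ha'] /andP[hb hb'].
  move: key ha ha' hb hb' t0; move: `|x| `|_ + _| `|_ - _| (4 / d) (4 * M * e1 * t).
  move=> r a b z w; nra.
(* At parameter [t * c], the linear term of [ball_bound] is [eps * t / 2] by the choice of [e1], and
   the quadratic term is [eps * t / 2] by this choice of [t]. *)
pose t := eps / (2 * c ^+ 2 * (4 / d + 2)).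
have h0 : 0 < 4 / d + 2 by rewrite ltr_wpDl // divr_ge0 // ltW.
have t0 : 0 < t by rewrite divr_gt0 // !mulr_gt0 // exprn_gt0.
exists t => // x xM.
have -> : t *: y = (t * c) *: yh by rewrite /yh scalerA mulfK // gt_eqF.
apply: le_trans (ball_bound _ _ xM (mulr_gt0 t0 c0)) _.
rewrite le_eqVlt; apply/orP; left; apply/eqP.
rewrite e1E /t; field.
by rewrite !lt0r_neq0 //; lra.
Qed.

Lemma duality_lbound {R : realType} {E : normedModType R} (x y : E) :
  - (`|x| * `|y|) <= duality x y.
Proof.
apply: lb_le_inf; first by case: (duality_has_inf x y).
by move=> _ [t /= t0 <-]; exact: sqr_norm_slope_lbound.
Qed.

Lemma dualityxx {R : realType} {E : normedModType R} (x : E) :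
  duality x x = `|x| ^+ 2.
Proof.
have slopeE t : 0 < t -> sqr_norm_slope x x t = (1 + t / 2) * `|x| ^+ 2.
  move=> t0; rewrite /sqr_norm_slope -{1}[x]scale1r -scalerDl normrZ.
  rewrite gtr0_norm; last by lra.
  by field; rewrite gt_eqF.
apply/eqP; rewrite eq_le; apply/andP; split.
  apply/ler_addgt0Pr => e e0; pose t := e / (1 + `|x| ^+ 2).
  have h : 0 < 1 + `|x| ^+ 2 by rewrite ltr_wpDr ?sqr_ge0.
  have t0 : 0 < t by rewrite divr_gt0.
  have := duality_le_slope x x t t0; rewrite slopeE //.
  have : t * (1 + `|x| ^+ 2) = e by rewrite divfK // gt_eqF.
  have : 0 <= t * `|x| ^+ 2 by rewrite mulr_ge0 ?sqr_ge0 // ltW.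
  lra.
apply: lb_le_inf; first by case: (duality_has_inf x x).
move=> _ [t /= t0 <-]; rewrite slopeE //.
have := sqr_ge0 `|x|; nra.
Qed.

(** Smoothness turns the one-sided derivative into a two-sided one: the slopes along [y] and [- y]
    add up to a second difference divided by [2 * t], which is arbitrarily small. The reverse
    inequality is subadditivity. Linearity in the second argument follows. *)
Lemma dualityNr {R : realType} {E : normedModType R} (x y : E) :
  uniformly_gateaux_differentiable_norm E -> duality x (- y) = - duality x y.
Proof.
move=> uG; apply/eqP; rewrite -subr_eq0 opprK eq_le; apply/andP; split.
  apply/ler_addgt0Pr => e e0.
  have [t t0 /(_ x (lexx _)) ht] := sqr_norm_second_difference y `|x| e uG e0.
  have := duality_le_slope x y t t0; have := duality_le_slope x (- y) t t0.
  rewrite /sqr_norm_slope scalerN !ler_pdivlMr ?mulr_gt0 //.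
  have : 0 < e * t by rewrite mulr_gt0.
  move=> h1 h2 h3.
  have : (duality x y + duality x (- y)) * t <= e * t by lra.
  rewrite ler_pM2r //; lra.
have := duality_subadd x y (- y); have := duality_lbound x (y - y).
rewrite subrr normr0; lra.
Qed.

Lemma dualityDr {R : realType} {E : normedModType R} (x y z : E) :
  uniformly_gateaux_differentiable_norm E ->
  duality x (y + z) = duality x y + duality x z.
Proof.
move=> uG; apply/eqP; rewrite eq_le duality_subadd /=.
have := duality_subadd x (y + z) (- z); rewrite addrK dualityNr //; lra.
Qed.

Lemma dualityBr {R : realType} {E : normedModType R} (x y z : E) :
  uniformly_gateaux_differentiable_norm E ->
  duality x (y - z) = duality x y - duality x z.
Proof. by move=> uG; rewrite dualityDr // dualityNr. Qed.

Lemma duality_le_norm {R : realType} {E : normedModType R} (x y : E) :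
  uniformly_gateaux_differentiable_norm E -> duality x y <= `|x| * `|y|.
Proof.
by move=> uG; have := duality_lbound x (- y); rewrite dualityNr // normrN; lra.
Qed.

(** For positive [t] this is the infimum bounded by one slope; negative [t] reduces to it by
    oddness. Both signs are used later. *)
Lemma duality_subgradient {R : realType} {E : normedModType R}
  (x y : E) (t : R) : uniformly_gateaux_differentiable_norm E ->
  `|x| ^+ 2 + 2 * t * duality x y <= `|x + t *: y| ^+ 2.
Proof.
move=> uG.
have pos (w : E) (s : R) : 0 < s ->
    `|x| ^+ 2 + 2 * s * duality x w <= `|x + s *: w| ^+ 2.
  move=> s0; have := duality_le_slope x w s s0.
  rewrite /sqr_norm_slope ler_pdivlMr ?mulr_gt0 //; lra.
have [t0|t0|->] := ltgtP t 0; last by rewrite scale0r addr0; lra.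
  have := pos (- y) (- t).
  rewrite oppr_gt0 dualityNr // scalerN scaleNr (opprK (t *: y)) => /(_ t0).
  lra.
exact: pos.
Qed.

(** The duality mapping is norm-to-weak-star uniformly continuous on bounded sets. Adding the
    subgradient inequalities at [x'] along [t *: y] and at [x] along [- t *: y], then replacing [x']
    by [x], leaves the second difference at [x] plus an error of order [d]; [t] is fixed before
    [d]. *)
Lemma duality_unif_continuous {R : realType} {E : normedModType R}
  (y : E) (M eps : R) : uniformly_gateaux_differentiable_norm E -> 0 < eps ->
  exists2 d : R, 0 < d & forall x x' : E, `|x| <= M -> `|x - x'| <= d ->
    duality x' y <= duality x y + eps.
Proof.
move=> uG e0; have [t t0 ht] := sqr_norm_second_difference y M eps uG e0.
have [M0|M0] := ltP M 0.
  by exists 1 => // x x' xM; have := le_trans xM (ltW M0); have := normr_ge0 x; lra.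
have B0 : 0 <= t * `|y| by rewrite mulr_ge0 // ltW.
have D0 : 0 < 2 * (M + t * `|y|) + 1 + 2 * M by lra.
have [d [d0 d1 dD]] : exists d : R,
    [/\ 0 < d, d <= 1 & d * (2 * (M + t * `|y|) + 1 + 2 * M) <= eps * t].
  exists (Num.min 1 (eps * t / (2 * (M + t * `|y|) + 1 + 2 * M))).
  split; first by rewrite lt_min ltr01 divr_gt0 // mulr_gt0.
    by rewrite ge_min lexx.
  by rewrite -ler_pdivlMr // ge_min lexx orbT.
exists d => // x x' xM xd.
have h1 := duality_subgradient x' y t uG.
have h2 := duality_subgradient x y (- t) uG; rewrite scaleNr in h2.
have h3 := ht x xM.
have h4 : `|x' + t *: y| <= `|x + t *: y| + d.
  rewrite -lerBlDl; apply: le_trans (lerB_dist _ _) _.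
  by rewrite opprD addrACA subrr addr0 distrC.
have h5 : `|x| - d <= `|x'|.
  by rewrite lerBlDl -lerBlDr; apply: le_trans (lerB_dist _ _) _.
have h6 : `|x + t *: y| <= M + t * `|y|.
  by apply: le_trans (ler_normD _ _) _; rewrite normrZ gtr0_norm // lerD2r.
suff : (duality x' y - duality x y) * (2 * t) <= eps * (2 * t).
  by rewrite ler_pM2r ?mulr_gt0 //; lra.
have h7 : `|x' + t *: y| ^+ 2 <= (`|x + t *: y| + d) ^+ 2.
  by rewrite ler_sqr ?nnegrE // (le_trans _ h4).
have h8 : `|x| ^+ 2 - 2 * `|x| * d <= `|x'| ^+ 2.
  have : 0 <= (`|x'| - `|x|) ^+ 2 by rewrite sqr_ge0.
  have : 0 <= `|x| by []. nra.
have h9 : `|x| * d <= M * d by rewrite ler_pM2r.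
have h10 : `|x + t *: y| * d <= (M + t * `|y|) * d by rewrite ler_pM2r.
have h11 : d ^+ 2 <= d by rewrite expr2 ger_pMr.
lra.
Qed.

(** The modulus on the sphere is carried to all radii [r <= M] with a single [d]. If the midpoint
    has norm above [r - d], both [|a|] and [|b|] exceed [r - 2 * d], so [a] and [b] are close to [r]
    times unit vectors. *)
Lemma uniformly_convex_ball {R : realType} {E : normedModType R} (M eps : R) :
  uniformly_convex E -> 0 < eps ->
  exists2 d : R, 0 < d & forall (r : R) (a b : E), r <= M -> `|a| <= r ->
    `|b| <= r -> r - d < `|a + b| / 2 -> `|a - b| < eps.
Proof.
move=> uc e0; have [M0|M0] := leP M 0.
  exists 1 => // r a b rM ar br _; apply: le_lt_trans e0.
  by apply: le_trans (ler_normB _ _) _; lra.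
have e10 : 0 < eps / (2 * M) by rewrite divr_gt0 // mulr_gt0.
have [d1 d10 hd1] := uc _ e10.
(* The bound [eps / 8] keeps [a], [b] away from 0 and the unit vectors apart after normalization;
   the bound [eps * d1 / 16] contradicts the drop [d1] in the midpoint of the unit vectors, as
   [r >= eps / 2]. *)
have [d [d0 de dd]] : exists d : R,
    [/\ 0 < d, d <= eps / 8 & d <= eps * d1 / 16].
  exists (Num.min (eps / 8) (eps * d1 / 16)); split.
  - by rewrite lt_min !divr_gt0 // mulr_gt0.
  - by rewrite ge_min lexx.
  - by rewrite ge_min lexx orbT.
exists d => // r a b rM ar br hab; rewrite ltNge; apply/negP => eab.
have hD := ler_normD a b.
have hr : eps <= 2 * r.
  by apply: le_trans eab _; apply: le_trans (ler_normB _ _) _; lra.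
have normalize (v : E) : r - 2 * d < `|v| -> `|v| <= r ->
    exists2 v', `|v'| = 1 & `|v - r *: v'| <= 2 * d.
  move=> rv vr; have v0 : 0 < `|v| by lra.
  have v1 : `| `|v|^-1 *: v | = 1.
    by rewrite normrZ gtr0_norm ?invr_gt0 // mulVf // gt_eqF.
  exists (`|v|^-1 *: v) => //.
  rewrite -{1}[v](scalerKV (lt0r_neq0 v0)) -scalerBl normrZ v1 mulr1.
  rewrite distrC ger0_norm; lra.
have [||a' a1 aa] := normalize a; [lra|lra|].
have [||b' b1 bb] := normalize b; [lra|lra|].
have r0 : 0 < r by lra.
have rE (v : E) : r * `|v| = `|r *: v| by rewrite normrZ gtr0_norm.
have hB : eps / 2 <= r * `|a' - b'|.
  rewrite rE scalerBr.
  have := ler_normD (a - b - (r *: a' - r *: b')) (r *: a' - r *: b').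
  rewrite subrK.
  have -> : a - b - (r *: a' - r *: b') = (a - r *: a') - (b - r *: b').
    by rewrite !opprD !opprK addrACA.
  have := ler_normB (a - r *: a') (b - r *: b'); lra.
have hS : `|a + b| <= r * `|a' + b'| + 4 * d.
  rewrite rE scalerDr.
  have := ler_normD (a + b - (r *: a' + r *: b')) (r *: a' + r *: b').
  rewrite subrK opprD addrACA.
  have := ler_normD (a - r *: a') (b - r *: b'); lra.
have : eps / (2 * M) <= `|a' - b'|.
  rewrite ler_pdivrMr ?mulr_gt0 //.
  have : 0 <= `|a' - b'| by []. nra.
move=> /(hd1 _ _ a1 b1); nra.
Qed.

(** * Sunny retractions and asymptotic centers *)

Lemma convex_setD {R : realType} {E : normedModType R} (C : set E)
  (a b : E) (t : R) : @convex_set R E C -> C a -> C b -> 0 <= t <= 1 ->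
  C (t *: a + (1 - t) *: b).
Proof.
move=> Cc Ca Cb /andP[t0 t1].
have := Cc a b (Itv01 t0 t1); rewrite !inE => /(_ Ca Cb).
by [].
Qed.

(** Factoring out the total weight lets the induction run on partial sums whose weights do not add
    up to 1. *)
Lemma convex_set_sum {R : realType} {E : normedModType R} (C : set E)
    (b : nat -> R) (v : nat -> E) (n : nat) : @convex_set R E C ->
    (forall k, (0 < k <= n)%N -> 0 < b k) -> (forall k, (0 < k)%N -> C (v k)) ->
    (0 < n)%N ->
  exists2 w, C w &
    \sum_(1 <= k < n.+1) b k *: v k = (\sum_(1 <= k < n.+1) b k) *: w.
Proof.
move=> Cc b0 Cv; case: n b0 => // n + _; elim: n => [|n IH] b0.
  by exists (v 1%N); [exact: Cv | rewrite !big_nat1].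
have [k /andP[k0 kn]|w Cw wE] := IH; first by apply: b0; rewrite k0 leqW.
set s := \sum_(1 <= k < n.+2) b k.
have s0 : 0 <= s.
  rewrite /s big_nat_cond sumr_ge0 // => k; rewrite andbT => /andP[k0 kn].
  by rewrite ltW // b0 // k0 leqW.
have bn : 0 < b n.+2 by rewrite b0 // leqnn.
have sb : 0 < s + b n.+2 by rewrite ltr_wpDl.
exists ((s / (s + b n.+2)) *: w + (1 - s / (s + b n.+2)) *: v n.+2).
  apply: convex_setD => //; first exact: Cv.
  by rewrite divr_ge0 ?(ltW sb) //= ler_pdivrMr // mul1r lerDl ltW.
rewrite big_nat_recr //= wE [in RHS]big_nat_recr //= -/s scalerDr !scalerA.
congr (_ *: _ + _ *: _); field; by rewrite gt_eqF.
Qed.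

Lemma duality_scale_le {R : realType} {E : normedModType R} (x y : E) (a : R) :
  0 < a -> duality x (a *: y) <= a * duality x y.
Proof.
move=> a0; rewrite -ler_pdivrMl //.
apply: lb_le_inf; first by case: (duality_has_inf x y).
move=> _ [t /= t0 <-]; rewrite ler_pdivrMl //.
have := duality_le_slope x (a *: y) (t / a) (divr_gt0 t0 a0).
rewrite /sqr_norm_slope scalerA divfK ?gt_eqF // => /le_trans; apply.
rewrite le_eqVlt; apply/orP; left; apply/eqP; field.
by rewrite !gt_eqF.
Qed.

(** In the usual notation, [<u - q, J (y - q)> <= 0] for all [y] in [K]; in a Hilbert space with [K]
    convex, [q] is the metric projection of [u]. *)
Definition variational_solution {R : realType} {E : normedModType R}
    (K : set E) (u q : E) : Prop :=
  K q /\ forall y, K y -> duality (y - q) (u - q) <= 0.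

(** Testing each inequality at the other solution and adding gives
    [|p - q|^2 <= duality (p - q) (u - v)]. *)
Lemma variational_solution_nonexpansive {R : realType} {E : normedModType R}
    {K : set E} {u v p q : E} : uniformly_gateaux_differentiable_norm E ->
    variational_solution K u p -> variational_solution K v q ->
  `|p - q| <= `|u - v|.
Proof.
move=> uG [Kp hp] [Kq hq].
have h1 := hp q Kq; have h2 := hq p Kp.
rewrite -(opprB p q) -(opprB p u) duality_opp_opp in h1.
have : duality (p - q) ((p - q) - (u - v)) <= 0.
  have -> : p - q - (u - v) = (p - u) + (v - q).
    by rewrite opprD opprK addrACA [- q + v]addrC.
  by rewrite dualityDr //; lra.
rewrite dualityBr // dualityxx.
have := duality_le_norm (p - q) (u - v) uG.
have : 0 <= `|p - q| by []. have : 0 <= `|u - v| by [].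
move: `|p - q| `|u - v| => a b; nra.
Qed.

Lemma variational_solution_unique {R : realType} {E : normedModType R}
    {K : set E} {u p q : E} : uniformly_gateaux_differentiable_norm E ->
  variational_solution K u p -> variational_solution K u q -> p = q.
Proof.
move=> uG hp hq.
have := variational_solution_nonexpansive uG hp hq.
by rewrite subrr normr0 normr_le0 subr_eq0 => /eqP.
Qed.

Lemma nonexpansive_le {R : realType} {E : normedModType R} {C : set E}
    {f : E -> E} {x y : E} : nonexpansive C f -> C x -> C y ->
  `|f x - f y| <= `|x - y|.
Proof. by move=> fC Cx Cy; have := fC (x, y) (conj Cx Cy); rewrite /= mul1r. Qed.

(** Each property reduces to the two preceding estimates. Points of [K] solve their own inequality,
    and [Q x] also solves the inequality of any point on its ray through [x], because scaling the
    direction by [lambda >= 0] preserves the sign. *)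
Lemma variational_sunny {R : realType} {E : normedModType R} (C K : set E)
    (Q : E -> E) : uniformly_gateaux_differentiable_norm E -> K `<=` C ->
    (forall u, C u -> variational_solution K u (Q u)) ->
  sunny_nonexpansive_retraction C K Q.
Proof.
move=> uG KC hQ.
have Qfix y : K y -> Q y = y.
  move=> Ky; apply: (variational_solution_unique (K := K) (u := y)) => //.
    exact/hQ/KC.
  split=> // w _; have := duality_le_norm (w - y) (y - y) uG.
  by rewrite subrr normr0 mulr0.
split.
- split=> //; apply/seteqP; split => [_ [y Cy <-]|y Ky]; first by case: (hQ y Cy).
  by exists y; [exact: KC | exact: Qfix].
- move=> x l Cx l0 Cz.
  apply: (variational_solution_unique (K := K) uG (hQ _ Cz)).
  have [Kq hq] := hQ x Cx; split=> // y Ky; rewrite [Q x + _]addrC addrK.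
  have := hq y Ky; move: l0; rewrite le_eqVlt => /predU1P[<- _|l0 h].
    have := duality_le_norm (y - Q x) 0 uG.
    by rewrite scale0r normr0 mulr0.
  apply: le_trans (duality_scale_le _ _ _ l0) _; nra.
- move=> [x y] [/= Cx Cy]; rewrite mul1r.
  exact: (variational_solution_nonexpansive uG (hQ x Cx) (hQ y Cy)).
Qed.

(** Sunniness sends [Q u + s *: (u - Q u)] to [Q u], so nonexpansiveness against [y] makes the
    slopes at [Q u - y] along [u - Q u] nonnegative. Taking [s <= 1] keeps the point in [C]. *)
Lemma sunny_variational {R : realType} {E : normedModType R} (C K : set E)
    (Q : E -> E) (u : E) : uniformly_gateaux_differentiable_norm E ->
    @convex_set R E C -> K `<=` C -> sunny_nonexpansive_retraction C K Q ->
  C u -> variational_solution K u (Q u).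
Proof.
move=> uG Cc KC [[QCK Qfix] Qs Qn] Cu.
have Kq : K (Q u) by rewrite -QCK; exists u.
split=> // y Ky.
suff : 0 <= duality (Q u - y) (u - Q u).
  by rewrite -duality_opp_opp opprB dualityNr //; lra.
apply/ler_addgt0Pr => e e0.
have [t t0 ht] := duality_near_slope (Q u - y) (u - Q u) e e0.
pose s := Num.min t 1.
have s0 : 0 < s by rewrite lt_min t0 ltr01.
have s1 : s <= 1 by rewrite ge_min lexx orbT.
have st : s <= t by rewrite ge_min lexx.
have sE : s *: u + (1 - s) *: Q u = Q u + s *: (u - Q u).
  by rewrite scalerBr scalerBl scale1r addrCA.
have Cz : C (Q u + s *: (u - Q u)).
  by rewrite -sE; apply: convex_setD => //; [exact: KC | rewrite ltW].
have := nonexpansive_le Qn Cz (KC _ Ky).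
rewrite (Qs _ _ Cu (ltW s0) Cz) (Qfix _ Ky) addrAC => h.
have := ltW (ht s s0 st); apply: le_trans.
rewrite /sqr_norm_slope divr_ge0 ?mulr_ge0 ?(ltW s0) //.
by rewrite subr_ge0 ler_sqr ?nnegrE.
Qed.

(** [rho] is the least asymptotic radius over [C]. Points of nearly least radius lie close together
    by uniform convexity, so a minimizing sequence is Cauchy and its limit is the only center. *)
Lemma asymptotic_center {R : realType} {E : completeNormedModType R}
    (C : set E) (z : nat -> E) (y0 : E) (M : R) : uniformly_convex E ->
    closed C -> @convex_set R E C -> C y0 -> (forall n, `|z n - y0| <= M) ->
  exists rho q, [/\ 0 <= rho, C q,
    forall eps, 0 < eps -> \forall n \near \oo, `|z n - q| <= rho + eps,
    forall y r, C y -> (\forall n \near \oo, `|z n - y| <= r) -> rho <= r &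
    forall q', C q' ->
      (forall eps, 0 < eps -> \forall n \near \oo, `|z n - q'| <= rho + eps) ->
      q' = q].
Proof.
move=> uc Ccl Cc Cy0 zM.
pose A (r : R) y := C y /\ \forall n \near \oo, `|z n - y| <= r.
pose S := [set r | A r !=set0].
have S0 r y : A r y -> 0 <= r.
  by case=> _ [N _ hN]; apply: le_trans (hN N (leqnn N)).
have Sinf : has_inf S.
  split; first by exists M, y0; split=> //; apply: nearW.
  by exists 0 => r [y /S0].
pose rho := inf S.
have rho_le y r : C y -> (\forall n \near \oo, `|z n - y| <= r) -> rho <= r.
  by move=> Cy hy; apply: ge_inf; [case: Sinf | exists y].
have rho0 : 0 <= rho by apply: lb_le_inf => [|r [y /S0]//]; case: Sinf.
have diam eps : 0 < eps -> exists2 d, 0 < d &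
    forall a b, A (rho + d) a -> A (rho + d) b -> `|a - b| < eps.
  move=> e0; have [d d0 hd] := uniformly_convex_ball (rho + 1) eps uc e0.
  exists (Num.min 1 (d / 2)); first by rewrite lt_min ltr01 divr_gt0.
  set d' := Num.min _ _ => a b [Ca ha] [Cb hb].
  rewrite ltNge; apply/negP => eab.
  have d1 : d' <= 1 by rewrite ge_min lexx.
  have d2 : d' <= d / 2 by rewrite ge_min lexx orbT.
  have h01 : 0 <= (2^-1 : R) <= 1 by lra.
  (* Were [a] and [b] at distance [eps] or more, their midpoint would have radius at most
     [rho + d' - d], which is below [rho] since [d' <= d / 2]. *)
  have : rho <= rho + d' - d.
    apply: rho_le (convex_setD _ _ _ _ Cc Ca Cb h01) _.
    apply: filterS2 ha hb => n ha hb; rewrite leNgt; apply/negP => hn.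
    move: eab; rewrite leNgt distrC => /negP; apply.
    have -> : b - a = (z n - a) - (z n - b).
      by rewrite opprB [RHS]addrC addrA subrK.
    apply: (hd (rho + d')) => //; first lra.
    apply: lt_le_trans hn _; rewrite le_eqVlt; apply/orP; left; apply/eqP.
    have -> : 1 - 2^-1 = 2^-1 :> R by lra.
    rewrite -scalerDr mulrC.
    transitivity (`|2^-1 *: (z n - a + (z n - b))|); last first.
      by rewrite normrZ gtr0_norm // invr_gt0.
    congr (`| _ |); rewrite addrACA -opprD scalerBr.
    rewrite [_ *: (z n + _)]scalerDr -scalerDl.
    by rewrite (_ : 2^-1 + 2^-1 = 1 :> R) ?scale1r //; lra.
  lra.
have inv0 k : 0 < (k.+1%:R : R)^-1 by rewrite invr_gt0 ltr0n.
have ex (k : nat) : exists y, A (rho + k.+1%:R^-1) y.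
  have [r [v [Cv hv]] hr] := inf_adherent (inv0 k) Sinf.
  exists v; split=> //; apply: filterS hv => n /le_trans; apply; exact: ltW.
have [y hy] := choice ex.
have yA d : 0 < d -> \forall k \near \oo, A (rho + d) (y k).
  move=> d0; have := near_infty_natSinv_lt (PosNum d0).
  apply: filterS => k /= kd; have [Cy hk] := hy k; split=> //.
  by apply: filterS hk => n /le_trans; apply; rewrite lerD2l ltW.
have yc : cvg (y @ \oo).
  apply: cauchy_cvg; apply: cauchy_exP => e e0.
  have [d d0 hd] := diam e e0; have [N _ hN] := yA d d0.
  exists (y N); exists N => // k Nk; rewrite /= -ball_normE /=.
  by apply: hd; apply: hN => //=.
pose q := lim (y @ \oo).
have Cq : C q.
  apply: (closed_cvg C Ccl _ q yc); apply: nearW => k; by case: (hy k).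
have hq eps : 0 < eps -> \forall n \near \oo, `|z n - q| <= rho + eps.
  move=> e0; have e20 : 0 < eps / 2 by rewrite divr_gt0.
  have h1 := yA _ e20.
  have h2 : \forall k \near \oo, `|q - y k| <= eps / 2.
    by apply: cvgr_dist_le e20; exact: yc.
  have [k [[_ hk] kq]] := filter_ex (filterI h1 h2).
  apply: filterS hk => n hn.
  have := ler_distD (y k) (z n) q; rewrite [`|y k - q|]distrC.
  move: kq; rewrite /= -/q; lra.
exists rho, q; split=> // q' Cq' hq'; apply/eqP; rewrite -subr_eq0 -normr_le0.
apply/ler_addgt0Pr => e e0; rewrite add0r.
have [d d0 hd] := diam e e0.
by apply/ltW/hd; split=> //; [exact: hq' | exact: hq].
Qed.

(** * Approximating curve *)

Lemma implicit_point_exists {R : realType} {E : completeNormedModType R}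
    (C : set E) (S : E -> E) (u : E) (t : R) : closed C ->
    @convex_set R E C -> set_fun C C S -> nonexpansive C S -> C u ->
    0 < t <= 1 ->
  exists2 z, C z & z = t *: u + (1 - t) *: S z.
Proof.
move=> Ccl Cc SC Sn Cu /andP[t0 t1].
pose f y := t *: u + (1 - t) *: S y.
have fC : {homo f : y / C y >-> C y}.
  by move=> y Cy; apply: convex_setD; rewrite ?(ltW t0) //; exact: SC.
have q0 : 0 <= 1 - t by rewrite subr_ge0.
have [||z Cz zE] := @banach_fixed_point R E C (mkfun fC) _ Ccl.
- exists (NngNum q0); split => /=; first lra.
  move=> [x y] [/= Cx Cy]; rewrite opprD addrACA subrr add0r -scalerBr normrZ.
  by rewrite ger0_norm // ler_wpM2l // (nonexpansive_le Sn).
- by exists u.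
- by exists z.
Qed.

Lemma implicit_point_gap {R : realType} {E : normedModType R}
    (S : E -> E) (u z p : E) (t : R) : 0 < t <= 1 ->
    z = t *: u + (1 - t) *: S z ->
  `|z - p| <= t * `|u - p| + (1 - t) * `|S z - p|.
Proof.
move=> /andP[t0 t1] zE; rewrite {1}zE convex_subE.
apply: le_trans (ler_normD _ _) _.
by rewrite !normrZ gtr0_norm // ger0_norm // subr_ge0.
Qed.

Lemma implicit_point_le {R : realType} {E : normedModType R} (C : set E)
    (S : E -> E) (u z p : E) (t : R) : nonexpansive C S -> 0 < t <= 1 ->
    z = t *: u + (1 - t) *: S z -> C z -> C p -> S p = p ->
  `|z - p| <= `|u - p|.
Proof.
move=> Sn t01 zE Cz Cp Sp; have := implicit_point_gap _ _ _ p _ t01 zE.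
have := nonexpansive_le Sn Cz Cp; rewrite Sp.
case/andP: t01 => t0 t1; move: `|z - p| `|u - p| `|S z - p| => a b c h1 h2.
rewrite -(ler_pM2l t0); nra.
Qed.

(** The implicit equation reads [z - p - t (u - p) = (1 - t) (S z - p)], of norm at most
    [(1 - t) |z - p|]. The factor [1/2] comes from [2 t - t^2 >= t]. *)
Lemma implicit_point_duality_ge {R : realType} {E : normedModType R}
    (C : set E) (S : E -> E) (u z p : E) (t : R) :
    uniformly_gateaux_differentiable_norm E -> nonexpansive C S ->
    0 < t <= 1 -> z = t *: u + (1 - t) *: S z -> C z -> C p -> S p = p ->
  2^-1 * `|z - p| ^+ 2 <= duality (z - p) (u - p).
Proof.
move=> uG Sn /andP[t0 t1] zE Cz Cp Sp.
have := duality_subgradient (z - p) (u - p) (- t) uG.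
have -> : z - p + - t *: (u - p) = (1 - t) *: (S z - p).
  by rewrite {1}zE convex_subE scaleNr addrAC subrr add0r.
rewrite normrZ ger0_norm ?subr_ge0 // => h1.
have h2 : `|S z - p| <= `|z - p| by rewrite -{1}Sp; exact: (nonexpansive_le Sn).
have h3 : ((1 - t) * `|S z - p|) ^+ 2 <= ((1 - t) * `|z - p|) ^+ 2.
  by rewrite ler_sqr ?nnegrE ?mulr_ge0 ?subr_ge0 // ler_wpM2l ?subr_ge0.
have h4 : (2 * t - t ^+ 2) * `|z - p| ^+ 2 <= 2 * t * duality (z - p) (u - p).
  by lra.
have h5 : t * `|z - p| ^+ 2 <= (2 * t - t ^+ 2) * `|z - p| ^+ 2.
  by rewrite ler_wpM2r ?sqr_ge0 //; nra.
suff : 2 * t * (2^-1 * `|z - p| ^+ 2) <= 2 * t * duality (z - p) (u - p).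
  by rewrite ler_pM2l // mulr_gt0.
lra.
Qed.

(** Divided by [2 * t], the bound is of order [t + d / t]: [t] has to be chosen small first, then
    [d] small relative to [t]. *)
Lemma implicit_point_duality_le {R : realType} {E : normedModType R}
    (C : set E) (S : E -> E) (u z y : E) (t B d : R) :
    uniformly_gateaux_differentiable_norm E -> nonexpansive C S ->
    0 < t <= 1 -> z = t *: u + (1 - t) *: S z -> C z -> C y ->
    `|y - z| <= B -> `|y - S y| <= d -> d <= 1 ->
  2 * t * duality (y - z) (u - z) <= t ^+ 2 * B ^+ 2 + (2 * B + 1) * d.
Proof.
move=> uG Sn /andP[t0 t1] zE Cz Cy yB yd d1.
have := duality_subgradient (y - z) (u - y) t uG.
have -> : y - z + t *: (u - y) = - ((1 - t) *: (S z - y)).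
  rewrite -opprB -[t *: _]opprK -opprD; congr (- _).
  by rewrite {1}zE convex_subE addrAC subrr add0r.
rewrite normrN normrZ ger0_norm ?subr_ge0 // => h1.
have h2 : `|S z - y| <= `|y - z| + `|y - S y|.
  have := ler_distD (S y) (S z) y; rewrite [`|S y - y|]distrC.
  have := nonexpansive_le Sn Cz Cy; rewrite [`|z - y|]distrC; lra.
have h3 : duality (y - z) (u - z) = duality (y - z) (u - y) + `|y - z| ^+ 2.
  by rewrite -dualityxx -dualityDr // subrKA.
have r0 : 0 <= `|y - z| by []. have e0 : 0 <= `|y - S y| by [].
have h4 : ((1 - t) * `|S z - y|) ^+ 2
    <= (1 - t) ^+ 2 * (`|y - z| + `|y - S y|) ^+ 2.
  rewrite -exprMn ler_sqr ?nnegrE ?mulr_ge0 ?subr_ge0 ?addr_ge0 //.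
  by rewrite ler_wpM2l ?subr_ge0.
rewrite h3; move: h1 h4 r0 e0 yB yd; move: (duality _ _).
move: `|y - z| `|y - S y| `|S z - y| => r e w J h1 h4 r0 e0 rB ed.
have hr : r ^+ 2 <= B ^+ 2 by rewrite ler_sqr ?nnegrE // (le_trans r0).
have he : (2 * r + e) * e <= (2 * B + 1) * d.
  by apply: ler_pM => //; lra.
have ht : (1 - t) ^+ 2 * ((2 * r + e) * e) <= 1 * ((2 * r + e) * e).
  by rewrite ler_wpM2r ?mulr_ge0 //; [lra | nra].
have htr : t ^+ 2 * r ^+ 2 <= t ^+ 2 * B ^+ 2 by rewrite ler_wpM2l ?sqr_ge0.
lra.
Qed.

(* A quantitative form, uniform in the point and in the index of [V], of
   "[V n] is strongly nonexpansive and its almost fixed points are almost fixed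
   by [T k]". *)
Definition gap_controls {R : realType} {E : normedModType R} (C F : set E)
    (V : nat -> E -> E) (S : nat -> E -> E) (k : nat) : Prop :=
  forall M eps : R, 0 < eps -> exists2 d : R, 0 < d &
    forall n y p, (k <= n)%N -> (0 < n)%N -> C y -> F p -> `|y - p| <= M ->
      `|y - p| - d < `|V n y - p| -> `|y - S n y| < eps.

Section Resolvents.
Context {R : realType} {E : completeNormedModType R}.
Variables (C : set E) (T V : nat -> E -> E).
Hypothesis uc : uniformly_convex E.
Hypothesis uG : uniformly_gateaux_differentiable_norm E.
Hypotheses (C_closed : closed C) (C_convex : @convex_set R E C).
Hypothesis T_self : forall n, (0 < n)%N -> set_fun C C (T n).
Hypothesis T_nonexp : forall n, (0 < n)%N -> nonexpansive C (T n).
Hypothesis V_nonexp : forall n, (0 < n)%N -> nonexpansive C (V n).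
Let F := common_fixed_points C T.
Hypothesis F_neq0 : F !=set0.
Hypothesis V_fix : forall n p, (0 < n)%N -> F p -> V n p = p.
Hypothesis V_gap : forall k, (0 < k)%N -> gap_controls C F V (fun=> T k) k.

Lemma common_fixed_pointsS : F `<=` C.
Proof. by move=> p /(_ 1%N isT)[]. Qed.

Variable u : E.
Hypothesis Cu : C u.

Let t (n : nat) : R := n.+1%:R^-1.

Lemma resolvent_param_itv n : 0 < t n <= 1.
Proof. by rewrite invr_gt0 ltr0n /= invf_le1 ?ltr0n // ler1n. Qed.

Variable z : nat -> E.
Hypothesis Cz : forall n, C (z n).
Hypothesis zE : forall n, z n = t n *: u + (1 - t n) *: V n.+1 (z n).

Lemma resolvent_le n p : F p -> `|z n - p| <= `|u - p|.
Proof.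
move=> Fp; apply: (implicit_point_le C (V n.+1) _ _ _ (t n)) => //.
- exact: V_nonexp.
- exact: resolvent_param_itv.
- exact: common_fixed_pointsS.
- exact: V_fix.
Qed.

Lemma resolvent_param_lt (e : R) : 0 < e -> \forall n \near \oo, t n < e.
Proof. by move=> e0; exact: near_infty_natSinv_lt (PosNum e0). Qed.

(** The implicit equation lets [V n.+1] reduce the distance of [z n] to [p] by at most
    [t n * |u - p|], which eventually falls below the threshold of [V_gap]. *)
Lemma resolvent_almost_fixed k (e : R) : (0 < k)%N -> 0 < e ->
  \forall n \near \oo, `|z n - T k (z n)| <= e.
Proof.
move=> k0 e0; have [p Fp] := F_neq0.
have [d d0 hd] := V_gap k k0 `|u - p| e e0.
have h0 : 0 < `|u - p| + 1 by rewrite ltr_wpDl.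
have h1 := resolvent_param_lt _ (divr_gt0 d0 h0).
apply: filterS2 (nbhs_infty_ge k) h1 => n kn.
rewrite ltr_pdivlMr // => tn; apply/ltW/(hd n.+1 _ p) => //.
- by rewrite leqW.
- exact: resolvent_le.
have [t0 t1] := andP (resolvent_param_itv n).
have := implicit_point_gap _ _ _ p _ (resolvent_param_itv n) (zE n).
have : 0 <= `|V n.+1 (z n) - p| by [].
nra.
Qed.

Lemma resolvent_cvg : exists2 q, F q & z @ \oo --> q.
Proof.
have [p Fp] := F_neq0.
have [rho [q [rho0 Cq hq rho_le quniq]]] := asymptotic_center C z p `|u - p| uc
  C_closed C_convex (common_fixed_pointsS _ Fp) (fun n => resolvent_le n p Fp).
have Fq : F q.
  (* [T k q] has the same asymptotic radius as [q], so uniqueness of the center gives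
     [T k q = q]. *)
  move=> k k0; split=> //; apply: quniq => [|e e0]; first exact: T_self.
  have e20 : 0 < e / 2 by rewrite divr_gt0.
  apply: filterS2 (resolvent_almost_fixed k _ k0 e20) (hq _ e20) => n h1 h2.
  have := nonexpansive_le (T_nonexp k k0) (Cz n) Cq.
  have := ler_distD (T k (z n)) (z n) (T k q); lra.
exists q => //.
suff rho_eq0 : rho = 0.
  apply/cvgrPdist_le => e e0; apply: filterS (hq e e0) => n.
  by rewrite rho_eq0 add0r distrC.
apply/eqP; rewrite eq_le rho0 andbT leNgt; apply/negP => rho_gt0.
(* Compare [q] with [q + s (u - q)] for one small [s]: the duality inequality
   makes the latter a strictly better centre unless [rho = 0]. *)
have e0 : 0 < rho ^+ 2 / 8 by rewrite divr_gt0 // exprn_gt0.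
have [d d0 hd] :=
  duality_unif_continuous (u - q) (2 * `|u - q|) (rho ^+ 2 / 8) uG e0.
have h0 : 0 < `|u - q| + 1 by rewrite ltr_wpDl.
pose s := Num.min 1 (d / (`|u - q| + 1)).
have s0 : 0 < s by rewrite lt_min ltr01 divr_gt0.
have s1 : s <= 1 by rewrite ge_min lexx.
have sd : s * `|u - q| <= d.
  have : s <= d / (`|u - q| + 1) by rewrite ge_min lexx orbT.
  rewrite ler_pdivlMr //; apply: le_trans; rewrite ler_wpM2l ?(ltW s0) //.
  by rewrite lerDl.
(* This excess over [rho] is small enough for [h8]: even with it, the new radius is at most
   [rho * (1 - s / 4)]. *)
have eta0 : 0 < rho * s / 12 by rewrite divr_gt0 // mulr_gt0.
have : rho <= rho * (1 - s / 4).
  apply: (rho_le (s *: u + (1 - s) *: q)).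
    by apply: convex_setD => //; rewrite s1 ltW.
  apply: filterS (hq _ eta0) => n hn.
  have zq := resolvent_le n q Fq.
  have vE : z n - (s *: u + (1 - s) *: q) = z n - q - s *: (u - q).
    rewrite -addrA; congr (_ + _); rewrite -opprD; congr (- _).
    by rewrite scalerBr scalerBl scale1r addrCA.
  rewrite vE; set v := z n - q - _.
  have vz : `|v - (z n - q)| <= d.
    by rewrite /v addrAC subrr add0r normrN normrZ gtr0_norm.
  have vM : `|v| <= 2 * `|u - q|.
    apply: le_trans (ler_normB _ _) _; rewrite normrZ gtr0_norm //.
    have : 0 <= `|u - q| by []. nra.
  (* The subgradient inequality [h3] is based at [v] and the lower bound [h2] at [z n - q];
     continuity of the duality mapping links them. *)
  have h1 := hd v (z n - q) vM vz.
  have h2 := implicit_point_duality_ge C (V n.+1) u (z n) q (t n) uG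
    (V_nonexp n.+1 isT) (resolvent_param_itv n) (zE n) (Cz n) Cq
    (V_fix n.+1 q isT Fq).
  have h3 := duality_subgradient v (u - q) s uG; rewrite subrK in h3.
  have h4 : `|z n - q| ^+ 2 <= (rho + rho * s / 12) ^+ 2.
    by rewrite ler_sqr ?nnegrE // addr_ge0 // ltW.
  rewrite -ler_sqr ?nnegrE //; last first.
    by rewrite mulr_ge0 //; lra.
  have h5 : 2 * s * (2^-1 * `|z n - q| ^+ 2)
      <= 2 * s * (duality v (u - q) + rho ^+ 2 / 8).
    by rewrite ler_wpM2l ?mulr_ge0 ?(ltW s0) //; lra.
  have h6 : `|v| ^+ 2 <= (1 - s) * `|z n - q| ^+ 2 + s * rho ^+ 2 / 4 by lra.
  have h7 : (1 - s) * `|z n - q| ^+ 2 <= (1 - s) * (rho + rho * s / 12) ^+ 2.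
    by rewrite ler_wpM2l ?subr_ge0.
  have h8 : (1 - s) * (1 + s / 12) ^+ 2 + s / 4 <= (1 - s / 4) ^+ 2 by nra.
  have := ler_wpM2l (sqr_ge0 rho) h8; lra.
have : 0 < rho * s by rewrite mulr_gt0.
lra.
Qed.

(** The variational inequality in a form stable under perturbation: [y] need only be almost fixed by
    one [V n], so that it applies to the iterates as well as to common fixed points. *)
Lemma resolvent_limit_duality_le q (M e : R) : F q -> z @ \oo --> q -> 0 < e ->
  exists n (d : R), [/\ (0 < n)%N, 0 < d &
    forall y, C y -> `|y - q| <= M -> `|y - V n y| <= d ->
      duality (y - q) (u - q) <= e].
Proof.
move=> Fq zq e0; pose B := `|M| + 1; have B1 : 1 <= B by rewrite lerDr.
have B0 : 0 < B by lra.
have e30 : 0 < e / 3 by rewrite divr_gt0.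
have [d1 d10 hd1] := duality_unif_continuous (u - q) B (e / 3) uG e30.
have eB : 0 < Num.min (Num.min 1 d1) (e / (6 * B)).
  by rewrite !lt_min ltr01 d10 divr_gt0 //; lra.
have eB2 : 0 < e / (3 * B ^+ 2) by rewrite divr_gt0 // mulr_gt0 // exprn_gt0.
move/cvgrPdist_le: zq => /(_ _ eB) zq.
have [n [zn tn]] := filter_ex (filterI zq (resolvent_param_lt _ eB2)).
move: zn; rewrite /= !le_min => /andP[/andP[zn1 znd]].
rewrite ler_pdivlMr ?mulr_gt0 // => znB.
move: tn; rewrite /= ltr_pdivlMr ?mulr_gt0 ?exprn_gt0 // => tnB.
have [t0 t1] := andP (resolvent_param_itv n).
(* The budget is [e / 3] for moving the base point from [y - q] to [y - z n], [e / 6] for replacing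
   [u - q] by [u - z n], and [e / 3] for the implicit estimate, shared equally by its terms in [t n]
   and [d]. *)
pose d := Num.min 1 (t n * e / (3 * (2 * B + 1))).
have d0 : 0 < d by rewrite lt_min ltr01 divr_gt0 ?mulr_gt0 //; lra.
have dle1 : d <= 1 by rewrite ge_min lexx.
have dB : d * (3 * (2 * B + 1)) <= t n * e.
  rewrite -ler_pdivlMr; last by lra.
  by rewrite ge_min lexx orbT.
exists n.+1, d; split=> // y Cy yM yV.
have yB : `|y - z n| <= B.
  have := ler_distD q y (z n); have := ler_norm M; rewrite /B; lra.
have h1 := implicit_point_duality_le C (V n.+1) u (z n) y (t n) B d uG
  (V_nonexp n.+1 isT) (resolvent_param_itv n) (zE n) (Cz n) Cy yB yV dle1.
have h2 : duality (y - q) (u - q) <= duality (y - z n) (u - q) + e / 3.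
  by apply: hd1 => //; rewrite opprB addrC subrKA.
have h3 : duality (y - z n) (u - q) =
    duality (y - z n) (u - z n) + duality (y - z n) (z n - q).
  by rewrite -dualityDr // subrKA.
have h4 := duality_le_norm (y - z n) (z n - q) uG.
have h5 : `|y - z n| * `|z n - q| <= B * `|z n - q| by rewrite ler_wpM2r.
have h6 : 2 * t n * duality (y - z n) (u - z n) <= 2 * t n * (e / 3).
  have : t n * (t n * (3 * B ^+ 2)) <= t n * e by rewrite ler_wpM2l // ltW.
  lra.
have {}h6 : duality (y - z n) (u - z n) <= e / 3.
  by move: h6; rewrite ler_pM2l // mulr_gt0.
rewrite distrC in znB; lra.
Qed.

End Resolvents.

(** * Averaged families *)

(** Splitting off [c *: (a + b)] leaves a vector of norm at most [(1 - 2 * c) * r]. So a combination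
    of norm near [r] forces [|a + b| / 2] near [r], uniformly over weights bounded below by [c]. *)
Lemma uniformly_convex_combination {R : realType} {E : normedModType R}
    (M eps c : R) : uniformly_convex E -> 0 < eps -> 0 < c ->
  exists2 d : R, 0 < d & forall (r c1 c2 : R) (a b w : E),
    r <= M -> `|a| <= r -> `|b| <= r -> c <= c1 -> c <= c2 ->
    `|w| <= (1 - c1 - c2) * r ->
    r - d < `|c1 *: a + c2 *: b + w| -> `|a - b| < eps.
Proof.
move=> uc e0 c0; have [d d0 hd] := uniformly_convex_ball M eps uc e0.
exists (2 * c * d); first by rewrite !mulr_gt0.
move=> r c1 c2 a b w rM ar br cc1 cc2 wr; set v := _ + w => rv.
apply: (hd r) => //.
have vE : v = c *: (a + b) + ((c1 - c) *: a + (c2 - c) *: b + w).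
  by rewrite scalerDr addrA addrACA -!scalerDl !subrKC.
have : `|v| <= c * `|a + b| + ((c1 - c) * `|a| + (c2 - c) * `|b| + `|w|).
  rewrite vE; apply: le_trans (ler_normD _ _) _.
  rewrite normrZ gtr0_norm // lerD2l; apply: le_trans (ler_normD _ _) _.
  rewrite lerD2r; apply: le_trans (ler_normD _ _) _.
  by rewrite !normrZ !ger0_norm // subr_ge0.
have h1 : (c1 - c) * `|a| <= (c1 - c) * r by rewrite ler_wpM2l // subr_ge0.
have h2 : (c2 - c) * `|b| <= (c2 - c) * r by rewrite ler_wpM2l // subr_ge0.
move=> h3; suff : c * (r - d) < c * (`|a + b| / 2) by rewrite ltr_pM2l.
lra.
Qed.

Lemma norm_weighted_sum_le {R : realType} {E : normedModType R}
    (s : seq nat) (P : pred nat) (b : nat -> R) (v : nat -> E) (r : R) :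
    (forall k, k \in s -> P k -> 0 <= b k) ->
    (forall k, k \in s -> P k -> `|v k| <= r) ->
  `|\sum_(k <- s | P k) b k *: v k| <= (\sum_(k <- s | P k) b k) * r.
Proof.
move=> b0 vr; apply: le_trans (ler_norm_sum _ _ _) _.
rewrite mulr_suml big_seq_cond [leRHS]big_seq_cond.
apply: ler_sum => k /andP[ks Pk].
by rewrite normrZ ger0_norm ?b0 // ler_wpM2l ?b0 // vr.
Qed.

Section AveragedFamily.
Context {R : realType} {E : normedModType R}.
Variables (C : set E) (T : nat -> E -> E).
Hypothesis uc : uniformly_convex E.
Hypothesis C_convex : @convex_set R E C.
Hypothesis T_self : forall n, (0 < n)%N -> set_fun C C (T n).
Hypothesis T_nonexp : forall n, (0 < n)%N -> nonexpansive C (T n).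
Let F := common_fixed_points C T.
Variables (beta : nat -> nat -> R) (gamma : nat -> R) (g : R).
Hypothesis beta_gt0 : forall n k, (0 < k <= n)%N -> 0 < beta n k.
Hypothesis beta_sum :
  forall n, (0 < n)%N -> \sum_(1 <= k < n.+1) beta n k = 1.
Hypothesis beta_lb : forall k, (0 < k)%N ->
  exists2 b : R, 0 < b & forall n, (k <= n)%N -> b <= beta n k.
Hypothesis g_gt0 : 0 < g.
Hypothesis gamma_itv : forall n, (0 < n)%N -> g <= gamma n <= 1 - g.

Definition weighted_mean n y := \sum_(1 <= k < n.+1) beta n k *: T k y.

Definition averaged n y := gamma n *: y + (1 - gamma n) *: weighted_mean n y.

Lemma weighted_mean_self n : (0 < n)%N -> set_fun C C (weighted_mean n).
Proof.
move=> n0 y Cy.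
have [w Cw wE] := convex_set_sum C (beta n) (T^~ y) n C_convex (beta_gt0 n)
  (fun k k0 => T_self k k0 y Cy) n0.
by rewrite /weighted_mean wE beta_sum // scale1r.
Qed.

Lemma weighted_meanB n (y w : E) : (0 < n)%N ->
  weighted_mean n y - w = \sum_(1 <= k < n.+1) beta n k *: (T k y - w).
Proof.
move=> n0; rewrite -{1}[w]scale1r -(beta_sum n n0) scaler_suml -sumrB.
by apply: eq_bigr => k _; rewrite scalerBr.
Qed.

Lemma weighted_mean_dist_le n (y w : E) (r : R) : (0 < n)%N ->
    (forall k, (0 < k <= n)%N -> `|T k y - w| <= r) ->
  `|weighted_mean n y - w| <= r.
Proof.
move=> n0 hr; rewrite weighted_meanB //.
have := norm_weighted_sum_le (index_iota 1 n.+1) predT (beta n)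
  (fun k => T k y - w) r.
rewrite beta_sum // mul1r; apply=> k; rewrite mem_index_iota ltnS => kn _.
  exact/ltW/beta_gt0.
exact: hr.
Qed.

Lemma gamma_itv01 n : (0 < n)%N -> 0 <= gamma n <= 1.
Proof.
move=> /gamma_itv /andP[g1 g2]; apply/andP; split; have := g_gt0; lra.
Qed.

Lemma averaged_self n : (0 < n)%N -> set_fun C C (averaged n).
Proof.
move=> n0 y Cy; apply: convex_setD => //; first exact: weighted_mean_self.
exact: gamma_itv01.
Qed.

Lemma weighted_mean_nonexp n y w : (0 < n)%N -> C y -> C w ->
  `|weighted_mean n y - weighted_mean n w| <= `|y - w|.
Proof.
move=> n0 Cy Cw; rewrite /weighted_mean -sumrB.
have := norm_weighted_sum_le (index_iota 1 n.+1) predT (beta n)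
  (fun k => T k y - T k w) `|y - w|.
rewrite beta_sum // mul1r; under eq_bigr do rewrite scalerBr; apply=> k.
  by rewrite mem_index_iota ltnS => kn _; exact/ltW/beta_gt0.
rewrite mem_index_iota => /andP[k0 _] _.
exact: nonexpansive_le (T_nonexp k k0) Cy Cw.
Qed.

Lemma averaged_nonexp n : (0 < n)%N -> nonexpansive C (averaged n).
Proof.
move=> n0 [y w] [/= Cy Cw]; rewrite mul1r /averaged opprD addrACA -!scalerBr.
apply: norm_convex_le => //; first exact: gamma_itv01.
exact: weighted_mean_nonexp.
Qed.

Lemma averaged_fix n p : (0 < n)%N -> F p -> averaged n p = p.
Proof.
move=> n0 Fp.
have -> : averaged n p = gamma n *: p + (1 - gamma n) *: p.
  congr (_ + _ *: _); rewrite /weighted_mean big_nat_cond.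
  under eq_bigr => k /andP[/andP[k0 _] _] do rewrite (Fp k k0).2.
  by rewrite -big_nat_cond -scaler_suml beta_sum // scale1r.
by rewrite -scalerDl addrC subrK scale1r.
Qed.

Lemma T_dist_le k y p : (0 < k)%N -> C y -> F p -> `|T k y - p| <= `|y - p|.
Proof.
move=> k0 Cy Fp; have [Cp Tp] := Fp k k0.
by rewrite -{1}Tp; exact: nonexpansive_le (T_nonexp k k0) Cy Cp.
Qed.

(** In [averaged n y - p] the vectors [y - p] and [T k y - p] have weights at least [g] and [g * b],
    uniformly in [n >= k]; the other terms form the remainder [w]. *)
Lemma averaged_gap k : (0 < k)%N -> gap_controls C F averaged (fun=> T k) k.
Proof.
move=> k0 M e e0; have [b b0 hb] := beta_lb k k0.
have c0 : 0 < Num.min g (g * b) by rewrite lt_min g_gt0 mulr_gt0.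
have [d d0 hd] := uniformly_convex_combination M e _ uc e0 c0.
exists d => // n y p kn n0 Cy Fp yM gap.
have -> : y - T k y = (y - p) - (T k y - p) by rewrite opprB addrA subrK.
have /andP[g1 g2] := gamma_itv n n0; have bn := hb n kn.
pose w : E := \sum_(j <- index_iota 1 n.+1 | j != k) beta n j *: (T j y - p).
have kin : k \in index_iota 1 n.+1 by rewrite mem_index_iota k0 ltnS.
have kuniq : uniq (index_iota 1 n.+1) by exact: iota_uniq.
have wle : `|w| <= (1 - beta n k) * `|y - p|.
  have -> : 1 - beta n k = \sum_(j <- index_iota 1 n.+1 | j != k) beta n j.
    by rewrite -(beta_sum n n0) (bigD1_seq k) //= addrAC subrr add0r.
  apply: norm_weighted_sum_le => j; rewrite mem_index_iota ltnS => /andP[j0 jn] _.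
    by apply/ltW/beta_gt0; rewrite j0.
  exact: T_dist_le.
apply: (hd `|y - p| (gamma n) ((1 - gamma n) * beta n k) _ _
  ((1 - gamma n) *: w)) => //.
- exact: T_dist_le.
- by rewrite ge_min g1.
- apply: le_trans (_ : g * b <= _); first by rewrite ge_min lexx orbT.
  by apply: ler_pM => //; [exact: ltW | exact: ltW | move: g2; lra].
- rewrite normrZ ger0_norm; last by move: g_gt0 g1 g2; lra.
  have : (1 - gamma n) * `|w| <= (1 - gamma n) * ((1 - beta n k) * `|y - p|).
    by rewrite ler_wpM2l //; move: g_gt0 g1 g2; lra.
  lra.
- rewrite -addrA -scalerA -scalerDr.
  suff -> : beta n k *: (T k y - p) + w = weighted_mean n y - p.
    by rewrite -convex_subE.
  by rewrite weighted_meanB // [RHS](bigD1_seq k).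
Qed.

(** Here [y] is paired with the whole weighted mean, with zero remainder. The index 1 makes the
    estimate cover every positive [n]. *)
Lemma averaged_self_gap : gap_controls C F averaged averaged 1.
Proof.
move=> M e e0.
have [d d0 hd] := uniformly_convex_combination M e g uc e0 g_gt0.
exists d => // n y p _ n0 Cy Fp yM gap.
have /andP[g1 g2] := gamma_itv n n0.
have : `|y - weighted_mean n y| < e.
  have -> : y - weighted_mean n y = (y - p) - (weighted_mean n y - p).
    by rewrite opprB addrA subrK.
  apply: (hd `|y - p| (gamma n) (1 - gamma n) _ _ 0) => //.
  - apply: weighted_mean_dist_le => // k /andP[k0 _]; exact: T_dist_le.
  - by move: g_gt0 g2; lra.
  - by rewrite normr0 opprB addrA subrK subrr mul0r.
  - by rewrite addr0 -convex_subE.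
apply: le_lt_trans; rewrite distrC /averaged convex_subE subrr scaler0 add0r.
rewrite normrZ [`|_ - y|]distrC ger0_norm; last by move: g_gt0 g1 g2; lra.
by rewrite ler_piMl ?gerBl //; move: g_gt0 g1; lra.
Qed.

(** [averaged m] involves only [T 1] to [T m], so the least of finitely many thresholds serves.
    Halving [e] restores the strict inequality. *)
Lemma averaged_initial_gap m : (0 < m)%N ->
  gap_controls C F averaged (fun=> averaged m) m.
Proof.
move=> m0 M e e0.
have [d d0 hd] : exists2 d : R, 0 < d & forall k, (0 < k <= m)%N ->
    forall n y p, (k <= n)%N -> (0 < n)%N -> C y -> F p -> `|y - p| <= M ->
      `|y - p| - d < `|averaged n y - p| -> `|y - T k y| < e / 2.
  elim: {m0} m => [|m [d d0 hd]]; first by exists 1 => // k /andP[]; case: k.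
  have e20 : 0 < e / 2 by rewrite divr_gt0.
  have [d' d'0 hd'] := averaged_gap m.+1 isT M _ e20.
  exists (Num.min d d') => [|k /andP[k0 km] n y p kn n0 Cy Fp yM gap].
    by rewrite lt_min d0.
  have [dd dd'] : Num.min d d' <= d /\ Num.min d d' <= d'.
    by rewrite !ge_min !lexx orbT.
  move: km; rewrite leq_eqVlt => /predU1P[kE|km].
    by rewrite kE in kn *; apply: (hd' n y p) => //; lra.
  by apply: (hd k _ n y p) => //; [rewrite k0 -ltnS | lra].
exists d => // n y p mn n0 Cy Fp yM gap.
have h : `|weighted_mean m y - y| <= e / 2.
  apply: weighted_mean_dist_le => // k /andP[k0 km].
  rewrite distrC; apply/ltW/(hd k _ n y p) => //; first by rewrite k0.
  exact: leq_trans mn.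
have /andP[g1 g2] := gamma_itv m m0.
rewrite distrC /averaged convex_subE subrr scaler0 add0r normrZ ger0_norm.
  have : 0 <= `|weighted_mean m y - y| by []. move: g_gt0 g1 h; nra.
move: g_gt0 g2; lra.
Qed.

End AveragedFamily.

(** * The Halpern-type iteration *)

(** Once [theta] is at most [e'] it stays there, the bound being a convex combination with [e < e'].
    Otherwise each step loses at least [alpha n * (e' - e)], which divergence of the sum and
    nonnegativity exclude. *)
Lemma halpern_recursion_near_le {R : realType} (theta alpha : nat -> R)
    (N : nat) (e e' : R) : (0 < N)%N -> e < e' ->
    (forall n, (N <= n)%N -> 0 <= theta n) ->
    (forall n, (N <= n)%N -> 0 < alpha n <= 1) ->
    \sum_(1 <= k < n.+1) alpha k @[n --> \oo] --> +oo ->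
    (forall n, (N <= n)%N ->
      theta n.+1 <= (1 - alpha n) * theta n + alpha n * e) ->
  \forall n \near \oo, theta n <= e'.
Proof.
move=> N0 ee' theta0 alpha01 alpha_sum rec.
have [[n Nn hn]|far] := pselect (exists2 n, (N <= n)%N & theta n <= e').
  exists n => // m /= nm; rewrite -(subnK nm); elim: (m - n)%N => [//|j IH].
  have Nj : (N <= j + n)%N by rewrite (leq_trans Nn) ?leq_addl.
  have := rec _ Nj; rewrite addSn; have /andP[a0 a1] := alpha01 _ Nj.
  by move: IH; move: (theta _) (theta _) (alpha _) a0 a1 => p q a a0 a1; nra.
have {}far n : (N <= n)%N -> e' < theta n.
  by move=> Nn; rewrite ltNge; apply/negP => hn; apply: far; exists n.
pose S n := \sum_(1 <= k < n) alpha k.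
have drop j : (e' - e) * S (N + j)%N + theta (N + j)%N <= (e' - e) * S N + theta N.
  elim: j => [|j IH]; first by rewrite addn0.
  have Nj : (N <= N + j)%N by rewrite leq_addr.
  have := rec _ Nj; have := far _ Nj; have /andP[a0 a1] := alpha01 _ Nj.
  have -> : S (N + j.+1)%N = S (N + j)%N + alpha (N + j)%N.
    by rewrite /S addnS big_nat_recr //= addn_gt0 N0.
  rewrite addnS; move: IH a0 a1; move: (theta (N + j)%N) (alpha (N + j)%N).
  move=> p a; nra.
have ee0 : 0 < e' - e by rewrite subr_gt0.
(* Beyond this bound on the partial sums, [drop] would make [theta] negative. *)
move/cvgryPge : alpha_sum => /(_ (S N + theta N / (e' - e) + 1)) [K _ hK].
have := hK (N + K)%N (leq_addl _ _); have := drop K.+1; rewrite addnS -/(S _).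
have := theta0 (N + K).+1 (leqW (leq_addr _ _)).
move=> h1 h2 h3.
have := ler_wpM2l (ltW ee0) h3.
have : (e' - e) * (theta N / (e' - e)) = theta N by rewrite mulrC divfK // gt_eqF.
lra.
Qed.

Section HalpernIteration.
Context {R : realType} {E : normedModType R}.
Variables (C F : set E) (V : nat -> E -> E).
Hypothesis uG : uniformly_gateaux_differentiable_norm E.
Hypothesis C_convex : @convex_set R E C.
Hypothesis V_self : forall n, (0 < n)%N -> set_fun C C (V n).
Hypothesis V_nonexp : forall n, (0 < n)%N -> nonexpansive C (V n).
Hypothesis V_fix : forall n p, (0 < n)%N -> F p -> V n p = p.
Hypothesis V_self_gap : gap_controls C F V V 1.
Hypothesis V_initial_gap : forall m, (0 < m)%N ->
  gap_controls C F V (fun=> V m) m.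
Variables (u q : E) (alpha : nat -> R) (x : nat -> E).
Hypotheses (Cu : C u) (Cq : C q) (Fq : F q).
Hypothesis q_limit : forall M e : R, 0 < e ->
  exists n (d : R), [/\ (0 < n)%N, 0 < d &
    forall y, C y -> `|y - q| <= M -> `|y - V n y| <= d ->
      duality (y - q) (u - q) <= e].
Hypothesis alpha_itv : forall n, (0 < n)%N -> 0 < alpha n <= 1.
Hypothesis alpha_cvg0 : alpha @ \oo --> (0 : R).
Hypothesis alpha_sum : \sum_(1 <= k < n.+1) alpha k @[n --> \oo] --> +oo.
Hypothesis Cx1 : C (x 1%N).
Hypothesis x_rec : forall n, (0 < n)%N ->
  x n.+1 = alpha n *: u + (1 - alpha n) *: V n (x n).

Lemma iterate_in n : (0 < n)%N -> C (x n).
Proof.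
elim: n => // -[//|n] IH _; rewrite x_rec //.
apply: convex_setD => //; first exact: V_self (IH _).
by have /andP[a0 a1] := alpha_itv n.+1 isT; rewrite ltW.
Qed.

Lemma V_dist_le n : (0 < n)%N -> `|V n (x n) - q| <= `|x n - q|.
Proof.
move=> n0; rewrite -{1}(V_fix n q n0 Fq).
exact: nonexpansive_le (V_nonexp n n0) (iterate_in n n0) Cq.
Qed.

Let B := Num.max `|x 1%N - q| `|u - q|.

Lemma iterate_bounded n : (0 < n)%N -> `|x n - q| <= B.
Proof.
elim: n => // -[_ _|n /(_ isT) IH _]; first by rewrite le_max lexx.
rewrite x_rec // convex_subE; apply: norm_convex_le.
- by have /andP[a0 a1] := alpha_itv n.+1 isT; rewrite ltW.
- by rewrite le_max lexx orbT.
- exact: le_trans (V_dist_le _ _) IH.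
Qed.

(** A small decrease means that [V n] hardly reduces the distance of [x n] to [q], so [x n] is
    almost fixed by [V n] and by the fixed mapping [V m]. The first makes [x n.+1] close to [x n];
    the second then passes to [x n.+1], where [q_limit] applies. *)
Lemma duality_le_of_small_decrease (e : R) : 0 < e ->
  exists2 d : R, 0 < d & \forall n \near \oo,
    `|x n - q| - `|x n.+1 - q| < d ->
    duality (x n.+1 - q) (u - q) <= e.
Proof.
move=> e0; have [m [d [m0 d0 hd]]] := q_limit B e e0.
have d30 : 0 < d / 3 by rewrite divr_gt0.
have d60 : 0 < d / 6 by rewrite divr_gt0.
have [da da0 hda] := V_initial_gap m m0 B _ d30.
have [db db0 hdb] := V_self_gap B _ d60.
have dd0 : 0 < Num.min da db / 2 by rewrite divr_gt0 // lt_min da0.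
have B0 : 0 <= B by rewrite le_max normr_ge0.
have B10 : 0 < 2 * B + 1 by rewrite ltr_wpDl // mulr_ge0.
(* Half of the gap threshold goes to the decrease and half to the term [alpha n * B]; the bound
   [d / 6] keeps [|x n.+1 - x n|] within [d / 3]. *)
have eta0 : 0 < Num.min (Num.min da db / 2) (d / 6) / (2 * B + 1).
  by rewrite divr_gt0 // lt_min dd0.
exists (Num.min da db / 2) => //.
move/cvgrPdist_le: alpha_cvg0 => /(_ _ eta0) small.
apply: filterS3 (nbhs_infty_gt 0) (nbhs_infty_ge m) small => n n0 mn.
have /andP[a0 a1] := alpha_itv n n0.
rewrite sub0r normrN gtr0_norm // ler_pdivlMr // le_min => /andP[ad ad6] dec.
have [m1 m2] : Num.min da db <= da /\ Num.min da db <= db.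
  by rewrite !ge_min !lexx orbT.
have aB : 0 <= alpha n * B by rewrite mulr_ge0 // ltW.
have Cx := iterate_in n n0; have xB := iterate_bounded n n0.
have uB : `|u - q| <= B by rewrite le_max lexx orbT.
have step : `|x n.+1 - q| <= alpha n * B + `|V n (x n) - q|.
  rewrite x_rec // convex_subE; apply: le_trans (ler_normD _ _) _.
  rewrite !normrZ gtr0_norm // (@ger0_norm _ (1 - _)) ?subr_ge0 //.
  apply: lerD; first by rewrite ler_wpM2l // ltW.
  by rewrite ler_piMl // gerBl ltW.
have h1 : `|x n - V m (x n)| < d / 3.
  by apply: (hda n _ q) => //; lra.
have h2 : `|x n - V n (x n)| < d / 6.
  by apply: (hdb n _ q) => //; lra.
have h3 : `|x n.+1 - x n| <= d / 3.
  rewrite x_rec // convex_subE; apply: le_trans (ler_normD _ _) _.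
  rewrite !normrZ gtr0_norm // (@ger0_norm _ (1 - _)) ?subr_ge0 //.
  have h4 : `|u - x n| <= 2 * B.
    have := ler_distD q u (x n); rewrite [`|q - x n|]distrC; lra.
  have h5 : alpha n * `|u - x n| <= alpha n * (2 * B) by rewrite ler_wpM2l // ltW.
  have h6 : (1 - alpha n) * `|V n (x n) - x n| <= `|V n (x n) - x n|.
    by rewrite ler_piMl // gerBl ltW.
  rewrite [`|V n _ - _|]distrC in h6 *; lra.
apply: hd; [exact: iterate_in | exact: iterate_bounded |].
have := nonexpansive_le (V_nonexp m m0) Cx (iterate_in n.+1 isT).
have := ler_distD (x n) (x n.+1) (V m (x n.+1)).
have := ler_distD (V m (x n)) (x n) (V m (x n.+1)).
rewrite [`|x n - x n.+1|]distrC; lra.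
Qed.

Lemma halpern_cvg : x @ \oo --> q.
Proof.
have B0 : 0 <= B by rewrite le_max normr_ge0.
apply/cvgrPdist_le => e e0.
have e20 : 0 < e ^+ 2 / 4 by rewrite divr_gt0 // exprn_gt0.
have [d d0 hd] := duality_le_of_small_decrease _ e20.
have B10 : 0 < B ^+ 2 + 1 by rewrite ltr_wpDl // sqr_ge0.
(* This ensures [alpha n * B ^ 2 <= d ^ 2], also when [B] is 0. *)
have eta0 : 0 < d ^+ 2 / (B ^+ 2 + 1) by rewrite divr_gt0 // exprn_gt0.
move/cvgrPdist_le: (alpha_cvg0) => /(_ _ eta0) small.
have [N _ hN] := filterI (nbhs_infty_gt 0) (filterI hd small).
suff : \forall n \near \oo, `|x n - q| ^+ 2 <= e ^+ 2.
  by apply: filterS => n; rewrite ler_sqr ?nnegrE ?(ltW e0) // distrC.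
have N0 : (0 < N)%N by have [] := hN N (leqnn N).
apply: (halpern_recursion_near_le (fun n => `|x n - q| ^+ 2) alpha N
  (e ^+ 2 / 2)) => //.
- by have := exprn_gt0 2 e0; lra.
- by move=> n Nn; apply: alpha_itv; exact: leq_trans Nn.
move=> n Nn; have [n0 [dec]] := hN n Nn.
have /andP[a0 a1] := alpha_itv n n0.
rewrite /= sub0r normrN gtr0_norm // ler_pdivlMr // => ad.
have xB := iterate_bounded n n0.
have xB2 : `|x n - q| ^+ 2 <= B ^+ 2 by rewrite ler_sqr ?nnegrE.
have ae : 0 <= alpha n * e ^+ 2 by rewrite mulr_ge0 ?sqr_ge0 // ltW.
have [small_dec|large_dec] := ltP (`|x n - q| - `|x n.+1 - q|) d.
  have hJ := dec small_dec.
  have := duality_subgradient (x n.+1 - q) (u - q) (- alpha n) uG.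
  have -> : x n.+1 - q + - alpha n *: (u - q) = (1 - alpha n) *: (V n (x n) - q).
    by rewrite x_rec // convex_subE scaleNr addrAC subrr add0r.
  rewrite normrZ ger0_norm ?subr_ge0 // exprMn => h.
  have h1 : `|V n (x n) - q| ^+ 2 <= `|x n - q| ^+ 2.
    by rewrite ler_sqr ?nnegrE //; exact: V_dist_le.
  have h2 : (1 - alpha n) ^+ 2 * `|V n (x n) - q| ^+ 2
      <= (1 - alpha n) * `|x n - q| ^+ 2.
    apply: ler_pM => //; rewrite ?sqr_ge0 //.
    by rewrite expr2 ler_piMl ?subr_ge0 // gerBl ltW.
  have h3 := ler_wpM2l (ltW a0) hJ.
  lra.
(* A large decrease beats the loss [alpha n * B ^ 2] once [alpha n] is small. *)
have h1 : `|x n.+1 - q| ^+ 2 <= `|x n - q| ^+ 2 - d ^+ 2.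
  have : 0 <= `|x n.+1 - q| by [].
  move: large_dec d0; move: `|x n - q| `|x n.+1 - q| => r s; nra.
have h2 := ler_wpM2l (ltW a0) xB2.
lra.
Qed.

End HalpernIteration.

(** * Construction of the retraction, its uniqueness, and the strong convergence *)

Theorem theorem4p1 (R : realType) (E : completeNormedModType R)
    (E_uconvex : uniformly_convex E)
    (E_ugateaux : uniformly_gateaux_differentiable_norm E)
    (C : set E) (C_neq0 : C !=set0) (C_closed : closed C)
    (C_convex : @convex_set R E C)
    (T : nat -> E -> E)
    (T_self : forall n, (0 < n)%N -> set_fun C C (T n))
    (T_nonexp : forall n, (0 < n)%N -> nonexpansive C (T n))
    (alpha : nat -> R) (beta : nat -> nat -> R) (gamma : nat -> R)
    (alpha_itv : forall n, (0 < n)%N -> 0 < alpha n <= 1)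
    (alpha_cvg0 : alpha @ \oo --> (0 : R))
    (alpha_sum : \sum_(1 <= k < n.+1) alpha k @[n --> \oo] --> +oo)
    (beta_itv : forall n k, (0 < k <= n)%N -> 0 < beta n k <= 1)
    (gamma_itv : forall n, (0 < n)%N -> 0 < gamma n < 1)
    (F_neq0 : common_fixed_points C T !=set0)
    (beta_sum : forall n, (0 < n)%N -> \sum_(1 <= k < n.+1) beta n k = 1)
    (beta_inf : forall k, (0 < k)%N ->
      0 < inf [set beta n k | n in [set n | (k <= n)%N]])
    (gamma_inf : 0 < inf [set gamma n | n in [set n | (0 < n)%N]])
    (gamma_sup : sup [set gamma n | n in [set n | (0 < n)%N]] < 1)
    (u : E) (Cu : C u)
    (x : nat -> E) (Cx1 : C (x 1%N))
    (x_rec : forall n, (0 < n)%N ->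
      x n.+1 = alpha n *: u
        + (1 - alpha n) *: (gamma n *: x n
            + (1 - gamma n) *: \sum_(1 <= k < n.+1) beta n k *: T k (x n))) :
  exists Q : E -> E,
    [/\ sunny_nonexpansive_retraction C (common_fixed_points C T) Q,
        (forall Q' : E -> E,
          sunny_nonexpansive_retraction C (common_fixed_points C T) Q' ->
          forall z, C z -> Q' z = Q z) &
        x @ \oo --> Q u].
Proof.
pose F := common_fixed_points C T.
have FC : F `<=` C by exact: common_fixed_pointsS.
have beta_lb k : (0 < k)%N ->
    exists2 b : R, 0 < b & forall n, (k <= n)%N -> b <= beta n k.
  move=> k0; exists (inf [set beta n k | n in [set n | (k <= n)%N]]).
    exact: beta_inf.
  move=> n kn; apply: ge_inf; last by exists n.
  exists 0 => _ [j /= kj <-].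
  by have /andP[/ltW] := beta_itv j k (introT andP (conj k0 kj)).
have beta_gt0 n k : (0 < k <= n)%N -> 0 < beta n k by move/beta_itv/andP=> [].
(* A single margin keeps [gamma n] away from both 0 and 1. *)
pose g := Num.min (inf [set gamma n | n in [set n | (0 < n)%N]])
  (1 - sup [set gamma n | n in [set n | (0 < n)%N]]).
have g0 : 0 < g by rewrite lt_min gamma_inf subr_gt0.
have gamma_g n : (0 < n)%N -> g <= gamma n <= 1 - g.
  move=> n0; apply/andP; split.
    rewrite ge_min ge_inf //; last by exists n.
    by exists 0 => _ [j /= j0 <-]; have /andP[/ltW] := gamma_itv j j0.
  have : g <= 1 - gamma n; last by lra.
  rewrite ge_min lerD2l lerN2 ub_le_sup ?orbT //; last by exists n.
  by exists 1 => _ [j /= j0 <-]; have /andP[_ /ltW] := gamma_itv j j0.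
pose V := averaged T beta gamma.
have V_self n : (0 < n)%N -> set_fun C C (V n)
  by apply: (averaged_self C T C_convex T_self beta gamma g).
have V_nonexp n : (0 < n)%N -> nonexpansive C (V n)
  by apply: (averaged_nonexp C T T_nonexp beta gamma g).
have V_fix n p : (0 < n)%N -> F p -> V n p = p
  by apply: (averaged_fix C T beta gamma).
have V_gap k : (0 < k)%N -> gap_controls C F V (fun=> T k) k.
  by apply: (averaged_gap C T E_uconvex T_nonexp beta gamma g).
have limit v : C v -> exists q, F q /\ forall M e : R, 0 < e ->
    exists n (d : R), [/\ (0 < n)%N, 0 < d &
      forall y, C y -> `|y - q| <= M -> `|y - V n y| <= d ->
        duality (y - q) (v - q) <= e].
  move=> Cv.
  have ex n := implicit_point_exists C (V n.+1) v n.+1%:R^-1 C_closed C_convex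
    (V_self n.+1 isT) (V_nonexp n.+1 isT) Cv (resolvent_param_itv n).
  have /choice [z hz] : forall n, exists y, C y /\
      y = n.+1%:R^-1 *: v + (1 - n.+1%:R^-1) *: V n.+1 y.
    by move=> n; have [y Cy yE] := ex n; exists y.
  have Cz n := (hz n).1; have zE n := (hz n).2.
  have [q Fq zq] := resolvent_cvg C T V E_uconvex E_ugateaux C_closed C_convex
    T_self T_nonexp V_nonexp F_neq0 V_fix V_gap v Cv z Cz zE.
  exists q; split=> // M e e0.
  exact: (resolvent_limit_duality_le C T V E_ugateaux V_nonexp v z Cz zE q M e).
(* The guard [C v] makes [Q] total, with arbitrary values outside [C]. *)
have /choice [Q hQ] : forall v, exists q, C v -> F q /\ forall M e : R, 0 < e ->
    exists n (d : R), [/\ (0 < n)%N, 0 < d &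
      forall y, C y -> `|y - q| <= M -> `|y - V n y| <= d ->
        duality (y - q) (v - q) <= e].
  move=> v; have [/limit [q hq]|nCv] := pselect (C v); first by exists q.
  by exists v.
have Qvar v : C v -> variational_solution F v (Q v).
  move=> Cv; have [Fq hq] := hQ v Cv; split=> // y Fy.
  apply/ler_addgt0Pr => e e0; rewrite add0r.
  (* A point of [F] is exactly fixed by [V n], so it meets the closeness condition for any [d]. *)
  have [n [d [n0 d0 hd]]] := hq `|y - Q v| e e0.
  apply: hd => //; first exact: FC.
  by rewrite V_fix // subrr normr0 ltW.
exists Q; split.
- exact: variational_sunny.
- move=> Q' hQ' v Cv; apply: (variational_solution_unique E_ugateaux _ (Qvar v Cv)).
  exact: (sunny_variational C).
have [Fq hq] := hQ u Cu.
apply: (halpern_cvg C F V E_ugateaux C_convex V_self V_nonexp V_fix _ _ u (Q u)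
  alpha) => //.
- exact: (averaged_self_gap C T E_uconvex T_nonexp beta gamma g).
- by apply: (averaged_initial_gap C T E_uconvex T_nonexp beta gamma g).
- exact: FC.
Qed.
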